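(* Let $\lambda\in\mathbb{C}$. Let $g(z)$ be an analytic function, let $A(z)=\alpha_1 z+\alpha_2$ with $\alpha_1,\alpha_2\in\mathbb{C}$, $\alpha_1\neq 0$, be an affine map, and let $h(z)=\gamma\,(g\circ A)(z)$ with $\gamma\in\mathbb{C}$, $\gamma\neq 0$. Let $O_g$ and $O_h$ denote the fixed point operators of Kim's method with parameter $\lambda$ applied to $g$ and to $h$, respectively. Then $$(A\circ O_h\circ A^{-1})(z)=O_g(z)$$ for every $z$ at which these operators are defined; that is, $O_g$ and $O_h$ are affinely conjugated by $A$.
   Context: Kim's one-parameter family (with parameter $\lambda\in\mathbb{C}$) for solving $f(x)=0$ is the iteration $x_{k+1}=O_f(x_k)$, where the fixed point operator $O_f$ of the method applied to an analytic function $f$ is $$O_f(x)=y-\frac{1+\lambda u^2}{1-2u}\,\frac{f(y)}{f'(x)},\qquad y=x-\frac{f(x)}{f'(x)},\qquad u=\frac{f(y)}{f(x)}.$$ $O_f$ is considered at the points $x$ for which all expressions make sense ($x$ and $y$ lie in the domain of $f$, $f'(x)\neq 0$, $f(x)\neq 0$, $1-2u\neq 0$). *)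

(* Defs.v *)
(* Stdlib reals with Coquelicot's complex numbers. *)
From Stdlib Require Import Reals.
From Coquelicot Require Import Coquelicot.
Open Scope C_scope.

(* An analytic function with domain [D] is represented by an open [D : C -> Prop]
   and a total [f : C -> C] whose values outside [D] carry no meaning. *)
Definition analytic_at (f : C -> C) (z0 : C) : Prop :=
  exists a : nat -> C,
    locally z0 (fun z : C =>
      is_pseries (K := C_AbsRing) (V := C_NormedModule) a (z - z0) (f z)).

Definition analytic_on (D : C -> Prop) (f : C -> C) : Prop :=
  open D /\ forall z : C, D z -> analytic_at f z.

Definition newton (f : C -> C) (x : C) : C := x - f x / C_derive f x.

Definition kim_u (f : C -> C) (x : C) : C := f (newton f x) / f x.

Definition kim_op (lambda : C) (f : C -> C) (x : C) : C :=
  newton f x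
  - (1 + lambda * kim_u f x ^ 2) / (1 - 2 * kim_u f x)
    * (f (newton f x) / C_derive f x).

(* Division and [C_derive] are total here, so the points at which [kim_op]
   is meaningful for [f] analytic on [D] are singled out separately. *)
Definition kim_defined (D : C -> Prop) (f : C -> C) (x : C) : Prop :=
  D x /\ C_derive f x <> 0 /\ D (newton f x) /\ f x <> 0
  /\ 1 - 2 * kim_u f x <> 0.

Definition affine (alpha1 alpha2 z : C) : C := alpha1 * z + alpha2.

Definition affine_inv (alpha1 alpha2 z : C) : C := (z - alpha2) / alpha1.

Lemma affineK (alpha1 alpha2 z : C) :
  alpha1 <> 0 -> affine_inv alpha1 alpha2 (affine alpha1 alpha2 z) = z.
Proof. intros H; unfold affine, affine_inv; field; exact H. Qed.

Lemma affine_invK (alpha1 alpha2 z : C) :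
  alpha1 <> 0 -> affine alpha1 alpha2 (affine_inv alpha1 alpha2 z) = z.
Proof. intros H; unfold affine, affine_inv; field; exact H. Qed.

(* Main.v *)
(* Since [(g o A)' = alpha1 * (g' o A)], the Newton step of [h] at [A^-1 z] is
   carried by [A] to the Newton step of [g] at [z]; the factor [gamma] then cancels
   in [u] and in [f(y)/f'(x)], and [alpha1] turns the correction term of [O_h] into
   that of [O_g]. Coquelicot's [C_derive] takes the limit along the real direction
   only, so the chain rule with complex [alpha1] needs complex differentiability,
   which comes from the quadratic bound on the remainder of the power series. *)
Require Import Defs.
From Stdlib Require Import Reals Lra.
From Coquelicot Require Import Coquelicot.
Open Scope C_scope.

Lemma norm_lim_le {K : AbsRing} {V : NormedModule K} (u : nat -> V) (l : V) (B : R) :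
  filterlim u eventually (locally l) -> (forall n, (norm (u n) <= B)%R) ->
  (norm l <= B)%R.
Proof.
  intros Hu HB.
  apply (is_lim_seq_le (fun n => norm (u n)) (fun _ => B) (norm l) B HB).
  - exact (filterlim_comp _ _ _ u norm _ _ _ Hu (filterlim_norm l)).
  - apply is_lim_seq_const.
Qed.

(** Convergent partial sums are bounded, and each later term is the difference of two consecutive
    ones, so twice their bound works. Applied to a power series, this gives the Cauchy-type estimate
    on the coefficients. *)
Lemma series_term_bounded {K : AbsRing} {V : NormedModule K} (a : nat -> V) (l : V) :
  is_series a l -> exists M : R, forall n, (norm (a n) <= M)%R.
Proof.
  intros Ha.
  destruct (filterlim_bounded (sum_n a) (ex_intro _ l Ha)) as [M HM].
  exists (M + M)%R; intros [|n].
  - generalize (HM 0%nat) (norm_ge_0 (sum_n a 0%nat)).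
    rewrite sum_O; lra.
  - replace (a (S n)) with (minus (sum_n a (S n)) (sum_n a n)).
    + eapply Rle_trans; [apply norm_triangle|].
      rewrite norm_opp; apply Rplus_le_compat; apply HM.
    + rewrite sum_Sn; unfold minus.
      rewrite (plus_comm (sum_n a n)), <- plus_assoc.
      etransitivity; [apply f_equal, plus_opp_r | apply plus_zero_r].
Qed.

Lemma pow_n_C (x : C) (n : nat) : pow_n (K := C_AbsRing) x n = x ^ n.
Proof.
  induction n as [|n IH]; [reflexivity|].
  simpl pow_n; rewrite IH; reflexivity.
Qed.

Lemma sum_n_geom_le (q : R) (n : nat) :
  (0 <= q <= / 2)%R -> (sum_n (fun k => q ^ k) n <= 2)%R.
Proof.
  intros Hq; rewrite sum_n_Reals.
  (* Subtracting [q ^ n] strengthens the bound enough for the induction to close: the step needs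
     only [2 * q ^ S n <= q ^ n], that is [q <= / 2]. *)
  assert (H : (sum_f_R0 (fun k => q ^ k) n <= 2 - q ^ n)%R).
  { induction n as [|n IH]; simpl in *; [lra|].
    assert (0 <= q ^ n)%R by (apply pow_le; lra). nra. }
  assert (0 <= q ^ n)%R by (apply pow_le; lra). lra.
Qed.

(** The remainder is the sum of the series from index 2 on. With [q = Cmod w / r], its [k]-th term
    is at most [M * q ^ (2 + k)], and the geometric series of ratio [q <= / 2] contributes at most
    the factor 2. *)
Lemma pseries_remainder_le (a : nat -> C) (r : R) (M : R) (w s : C) :
  (0 < r)%R ->
  (forall n, (Cmod (a n) * r ^ n <= M)%R) ->
  (Cmod w <= r / 2)%R ->
  is_pseries (K := C_AbsRing) (V := C_NormedModule) a w s ->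
  (Cmod (s - (a 0%nat + w * a 1%nat)) <= 2 * M * (Cmod w / r) ^ 2)%R.
Proof.
  intros Hr HM Hw Hs.
  assert (Hs2 := is_series_incr_n (V := C_NormedModule)
    (fun k => scal (pow_n (K := C_AbsRing) w k) (a k)) 2
    (s - (a 0%nat + w * a 1%nat)) Nat.lt_0_2).
  refine (norm_lim_le _ _ _ (Hs2 _) _).
  - simpl Init.Nat.pred; rewrite sum_Sn, sum_O, !pow_n_C.
    replace (plus _ _) with s; [exact Hs|].
    change (s = s - (a 0%nat + w * a 1%nat) + (w ^ 0 * a 0%nat + w ^ 1 * a 1%nat)).
    ring.
  - intros n; unfold sum_n.
    eapply Rle_trans; [apply norm_sum_n_m|].
    set (q := (Cmod w / r)%R).
    assert (Hq : (0 <= q <= / 2)%R).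
    { unfold q; split.
      - apply Rdiv_le_0_compat; [apply Cmod_ge_0 | exact Hr].
      - apply Rle_div_l; [exact Hr | lra]. }
    assert (HM0 : (0 <= M)%R).
    { generalize (HM 0%nat) (Cmod_ge_0 (a 0%nat)); simpl; lra. }
    apply Rle_trans with (sum_n (fun k => scal (M * q ^ 2)%R (q ^ k)%R) n).
    + apply sum_n_m_le; intros k.
      rewrite pow_n_C.
      change (Cmod (w ^ (2 + k) * a (2 + k)%nat)
              <= M * q ^ 2 * q ^ k)%R.
      rewrite Cmod_mult, Cmod_pow.
      replace (Cmod w) with (q * r)%R by (unfold q; field; lra).
      rewrite Rpow_mult_distr.
      rewrite (Rmult_assoc M), <- pow_add.
      assert (0 <= q ^ (2 + k))%R by (apply pow_le; lra).
      generalize (HM (2 + k)%nat); nra.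
    + unfold sum_n; rewrite sum_n_m_scal_l.
      fold (sum_n (fun k => (q ^ k)%R) n).
      change ((M * q ^ 2) * sum_n (fun k => (q ^ k)%R) n <= 2 * M * q ^ 2)%R.
      generalize (sum_n_geom_le q n Hq).
      assert (0 <= M * q ^ 2)%R by (apply Rmult_le_pos; [|apply pow_le]; lra).
      nra.
Qed.

(** The derivative is the coefficient [a 1]: the remainder after the linear term is quadratic in the
    increment, hence negligible against it in every complex direction. *)
Lemma analytic_at_ex_derive (f : C -> C) (z0 : C) :
  analytic_at f z0 ->
  exists l : C, is_derive (K := C_AbsRing) (V := C_NormedModule) f z0 l.
Proof.
  intros [a Ha]; exists (a 1%nat).
  destruct (locally_norm_le_locally (V := C_NormedModule) z0 _ Ha) as [d Hd].
  (* Half the radius of the [Cmod] disc keeps the real point [r] strictly inside, so the series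
     converges there and its terms are bounded. *)
  set (r := (d / 2)%R).
  assert (Hr : (0 < r < d)%R) by (unfold r; generalize (cond_pos d); lra).
  assert (Hser : forall w : C, (Cmod w < d)%R ->
            is_pseries (K := C_AbsRing) (V := C_NormedModule) a w (f (z0 + w))).
  { intros w Hw.
    replace w with (z0 + w - z0) at 1 by ring.
    apply Hd; red.
    change (Cmod (z0 + w - z0) < d)%R.
    now replace (z0 + w - z0) with w by ring. }
  destruct (series_term_bounded _ _ (Hser (RtoC r)
    ltac:(rewrite Cmod_R, Rabs_pos_eq; lra))) as [M HM].
  assert (HM' : forall n, (Cmod (a n) * r ^ n <= M)%R).
  { intros n; generalize (HM n).
    rewrite pow_n_C; change (Cmod (RtoC r ^ n * a n) <= M -> Cmod (a n) * r ^ n <= M)%R.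
    rewrite Cmod_mult, Cmod_pow, Cmod_R, Rabs_pos_eq; lra. }
  assert (Hrem : forall w : C, (Cmod w <= r / 2)%R ->
     (Cmod (f (z0 + w)%C - (a 0%nat + w * a 1%nat)) <= 2 * M * (Cmod w / r) ^ 2)%R).
  { intros w Hw; apply pseries_remainder_le; trivial; [lra|].
    apply Hser; lra. }
  (* At increment 0 the quadratic bound vanishes, which forces this equality. *)
  assert (Ha0 : f z0 = a 0%nat).
  { generalize (Hrem 0 ltac:(rewrite Cmod_0; lra)).
    replace (z0 + 0) with z0 by ring.
    replace (f z0 - (a 0%nat + 0 * a 1%nat)) with (f z0 - a 0%nat) by ring.
    rewrite Cmod_0; intros H.
    replace (2 * M * (0 / r) ^ 2)%R with 0%R in H by (field; lra).
    assert (E : f z0 - a 0%nat = 0)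
      by (apply Cmod_eq_0; apply Rle_antisym; [exact H | apply Cmod_ge_0]).
    replace (f z0) with (f z0 - a 0%nat + a 0%nat) by ring.
    rewrite E; ring. }
  split; [apply is_linear_scal_l|].
  intros x Hx; rewrite <- (is_filter_lim_locally_unique _ _ Hx); clear x Hx.
  intros eps.
  assert (HM0 : (0 <= M)%R).
  { generalize (HM' 0%nat) (Cmod_ge_0 (a 0%nat)); simpl; lra. }
  set (B := (2 * M / r ^ 2)%R).
  assert (HB : (0 <= B)%R)
    by (apply Rdiv_le_0_compat; [lra | apply pow_lt; lra]).
  (* The first radius makes the remainder bound available; the second gives [B * Cmod w <= eps].
     Adding 1 keeps the denominator positive when [B] is 0. *)
  assert (Hdel : (0 < Rmin (r / 2) (eps / (B + 1)))%R).
  { apply Rmin_glb_lt; [lra|].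
    apply Rdiv_lt_0_compat; [apply cond_pos | lra]. }
  exists (mkposreal _ Hdel); refine (fun (y : C) (Hy : _) => _).
  change (Cmod (y - z0)%C < Rmin (r / 2) (eps / (B + 1)))%R in Hy.
  change (Cmod (f y - f z0 - (y - z0) * a 1%nat) <= eps * Cmod (y - z0))%R.
  set (w := y - z0) in *.
  assert (Hw1 : (Cmod w < r / 2)%R)
    by (eapply Rlt_le_trans; [exact Hy | apply Rmin_l]).
  assert (Hw2 : (Cmod w < eps / (B + 1))%R)
    by (eapply Rlt_le_trans; [exact Hy | apply Rmin_r]).
  apply Rlt_div_r in Hw2; [|lra].
  generalize (Hrem w (Rlt_le _ _ Hw1)).
  replace (z0 + w) with y by (unfold w; ring).
  rewrite Ha0.
  replace (f y - a 0%nat - w * a 1%nat) with (f y - (a 0%nat + w * a 1%nat)) by ring.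
  replace (2 * M * (Cmod w / r) ^ 2)%R with (B * Cmod w * Cmod w)%R
    by (unfold B; field; lra).
  generalize (Cmod_ge_0 w); nra.
Qed.

Lemma C_derive_scale_affine (g : C -> C) (alpha1 alpha2 gamma z : C) :
  analytic_at g (affine alpha1 alpha2 z) ->
  C_derive (fun x => gamma * g (affine alpha1 alpha2 x)) z
  = gamma * alpha1 * C_derive g (affine alpha1 alpha2 z).
Proof.
  intros Hg; destruct (analytic_at_ex_derive _ _ Hg) as [l Hl].
  rewrite (is_C_derive_unique _ _ _ Hl).
  apply is_C_derive_unique.
  assert (HA : is_derive (K := C_AbsRing) (V := AbsRing_NormedModule C_AbsRing)
                 (affine alpha1 alpha2) z alpha1).
  (* The derivative is put in the shape produced by the sum rule and by the product rule for a
     constant times the identity. *)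
  { replace alpha1 with
      (plus (plus (mult zero z) (mult alpha1 one)) zero : C_AbsRing) at 2.
    2:{ rewrite mult_zero_l, plus_zero_l, plus_zero_r; apply mult_one_r. }
    apply (is_derive_plus (V := AbsRing_NormedModule C_AbsRing)
             (fun x => alpha1 * x) (fun _ => alpha2)).
    - apply (is_derive_mult (K := C_AbsRing) (fun _ => alpha1) (fun x => x)).
      + apply (is_derive_const (V := AbsRing_NormedModule C_AbsRing)).
      + apply (is_derive_id (K := C_AbsRing)).
      + exact Cmult_comm.
    - apply (is_derive_const (V := AbsRing_NormedModule C_AbsRing)). }
  assert (H := is_derive_comp g _ z l alpha1 Hl HA).
  apply (filterdiff_scal_r_fct gamma) in H; [|exact Cmult_comm].
  refine (filterdiff_ext_lin _ _ _ H _); intros y.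
  change (gamma * (y * (alpha1 * l)) = y * (gamma * alpha1 * l)); ring.
Qed.

Lemma Cmult_neq_0_iff (c x : C) : c <> 0 -> (c * x <> 0 <-> x <> 0).
Proof.
  intros Hc; split; [|now apply Cmult_neq_0].
  intros H E; apply H; rewrite E; ring.
Qed.

Theorem theorem1 (lambda : C) (D : C -> Prop) (g : C -> C)
  (alpha1 alpha2 gamma : C)
  (hg : analytic_on D g) (halpha1 : alpha1 <> 0) (hgamma : gamma <> 0) :
  let A := affine alpha1 alpha2 in
  let Ainv := affine_inv alpha1 alpha2 in
  let h := fun z : C => gamma * g (A z) in
  let Dh := fun z : C => D (A z) in
  forall z : C,
    (kim_defined D g z <-> kim_defined Dh h (Ainv z)) /\
    (kim_defined D g z ->
       A (kim_op lambda h (Ainv z)) = kim_op lambda g z).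
Proof.
  intros A Ainv h Dh z.
  assert (HA : A (Ainv z) = z) by (apply affine_invK; exact halpha1).
  assert (Hhz : h (Ainv z) = gamma * g z) by (unfold h; now rewrite HA).
  assert (Hder : D z -> C_derive h (Ainv z) = gamma * alpha1 * C_derive g z).
  { intros Hz; rewrite <- HA at 2.
    apply C_derive_scale_affine.
    fold A; rewrite HA; now apply hg. }
  assert (Hne : D z -> (C_derive h (Ainv z) <> 0 <-> C_derive g z <> 0)).
  { intros Hz; rewrite (Hder Hz).
    now apply Cmult_neq_0_iff, Cmult_neq_0. }
  assert (Hnz : h (Ainv z) <> 0 <-> g z <> 0).
  { rewrite Hhz; now apply Cmult_neq_0_iff. }
  assert (Hnewton : D z -> C_derive g z <> 0 ->
                    A (newton h (Ainv z)) = newton g z).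
  { intros Hz Hg'; unfold newton; rewrite (Hder Hz), Hhz.
    unfold A, Ainv, affine, affine_inv; field; auto. }
  assert (Hhy : D z -> C_derive g z <> 0 ->
                h (newton h (Ainv z)) = gamma * g (newton g z)).
  { intros Hz Hg'; unfold h at 1; now rewrite Hnewton. }
  assert (Hu : D z -> C_derive g z <> 0 -> g z <> 0 ->
               kim_u h (Ainv z) = kim_u g z).
  { intros Hz Hg' Hgz; unfold kim_u; rewrite Hhy, Hhz by trivial.
    field; auto. }
  split.
  - unfold kim_defined, Dh; rewrite HA.
    split; intros (Hz & H1 & H2 & H3 & H4).
    + rewrite Hnewton, Hu by trivial; tauto.
    (* Nonvanishing is first carried over to [g], because [Hnewton] and [Hu] take their hypotheses
       on that side. *)
    + apply (Hne Hz) in H1; apply Hnz in H3.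
      rewrite Hnewton, Hu in * by trivial; tauto.
  - intros (Hz & H1 & H2 & H3 & H4).
    unfold kim_op; rewrite Hhy, Hu, (Hder Hz) by trivial.
    (* Both sides now share the atom [newton h (Ainv z)]. On the left, [A] multiplies the correction
       by [alpha1], cancelling the [alpha1] from the derivative of [h]. *)
    rewrite <- (Hnewton Hz H1).
    unfold A, affine; field; auto.
Qed.
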